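(* Let $\binom{r}{2} \leq n < \binom{r+1}{2}$ and $t := n - \binom{r}{2}$. Let $\mathcal{G}$ be a graph with $n$ edges and the maximum number of triangles (among all graphs with $n$ edges). 1. If $t = 0$, then $\mathcal{G}$ is the complete graph $K_r$. 2. If $t = 1$ and $\mathcal{G}$ is connected, then $\mathcal{G}$ is the graph obtained by attaching a vertex $v$ to a vertex of the complete graph $K_r$ with $1$ edge. 3. If $t = 1$ and $\mathcal{G}$ is disconnected, then $\mathcal{G}$ is the graph $K_2 \cup K_r$. 4. If $t \neq 0, 1$, then $\mathcal{G}$ is the graph obtained by attaching a vertex $v$ with $t$ edges to the complete graph $K_r$, where the $t$ edges are incident to $t$ vertices of $K_r$.
   Context: Graphs are simple, loopless and undirected. Here $n$ and $r$ are positive integers. A triangle of a graph is a set of three pairwise adjacent vertices. $K_m$ denotes the complete graph on $m$ vertices. For graphs $\mathcal{G}$ and $\mathcal{H}$, $\mathcal{G} \cup \mathcal{H}$ denotes the graph whose vertex set and edge set are the disjoint unions, respectively, of the vertex sets and edge sets of $\mathcal{G}$ and $\mathcal{H}$. Graphs are identified up to isomorphism.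
   Formalization: The graph G is assumed to have no isolated vertices; otherwise the claim fails, e.g. K_3 together with an isolated vertex has 3 edges and the maximum number of triangles but is not K_3. *)

(* Defs.v *)
From mathcomp Require Import all_boot.

Set Implicit Arguments.
Unset Strict Implicit.
Unset Printing Implicit Defensive.

Record sgraph := SGraph {
  vertex :> finType;
  adj : rel vertex;
  adj_sym : symmetric adj;
  adj_irrefl : irreflexive adj
}.

Definition edges (G : sgraph) : {set {set G}} :=
  [set [set p.1; p.2] | p : G * G & adj p.1 p.2].

Definition triangles (G : sgraph) : {set {set G}} :=
  [set A : {set G} | (#|A| == 3) &&
     [forall x in A, forall y in A, (x != y) ==> adj x y]].

(* Isolated vertices change neither the number of edges nor the number of
   triangles, so extremal graphs are only determined up to isolated vertices. *)
Definition no_isolated (G : sgraph) : Prop :=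
  forall x : G, exists y : G, adj x y.

(* The graph without vertices counts as connected here; it has no edges. *)
Definition connected_graph (G : sgraph) : Prop :=
  forall x y : G, connect (@adj G) x y.

Definition isomorphic (G H : sgraph) : Prop :=
  exists2 f : G -> H, bijective f & {mono f : x y / adj x y}.

Section Complete.
Variable m : nat.

Definition complete_adj : rel 'I_m := fun i j => i != j.

Lemma complete_adj_sym : symmetric complete_adj.
Proof. by move=> i j; rewrite /complete_adj eq_sym. Qed.

Lemma complete_adj_irrefl : irreflexive complete_adj.
Proof. by move=> i; rewrite /complete_adj eqxx. Qed.

Definition complete : sgraph := SGraph complete_adj_sym complete_adj_irrefl.

End Complete.

Section DisjointUnion.
Variables G H : sgraph.

Definition union_adj : rel (G + H)%type := fun u v =>
  match u, v with
  | inl x, inl y => adj x y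
  | inr x, inr y => adj x y
  | _, _ => false
  end.

Lemma union_adj_sym : symmetric union_adj.
Proof. by case=> x [] y //=; rewrite adj_sym. Qed.

Lemma union_adj_irrefl : irreflexive union_adj.
Proof. by case=> x /=; rewrite adj_irrefl. Qed.

Definition disjoint_union : sgraph := SGraph union_adj_sym union_adj_irrefl.

End DisjointUnion.

(* The new vertex is [None]; its neighbours are the elements of [S]. *)
Section AttachVertex.
Variables (G : sgraph) (S : {set G}).

Definition attach_adj : rel (option G) := fun u v =>
  match u, v with
  | Some x, Some y => adj x y
  | Some x, None | None, Some x => x \in S
  | None, None => false
  end.

Lemma attach_adj_sym : symmetric attach_adj.
Proof. by case=> [x|] [y|] //=; rewrite adj_sym. Qed.

Lemma attach_adj_irrefl : irreflexive attach_adj.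
Proof. by case=> [x|] //=; rewrite adj_irrefl. Qed.

Definition attach_vertex : sgraph := SGraph attach_adj_sym attach_adj_irrefl.

End AttachVertex.

(* Main.v *)
Require Import Defs.
From mathcomp Require Import all_boot.
From mathcomp Require Import zify.

(** Induction by deletion of a vertex of minimum degree proves that a graph
    with ['C(r, 2) + t] edges, [t < r], has at most ['C(r, 3) + 'C(t, 2)]
    triangles, and shows what equality forces.

    Let [d] be the minimum degree and [v] a vertex of degree [d].  A graph of
    minimum degree [d] has at least ['C(d.+1, 2)] edges, so [d < r]
    ([min_degree_ltn]).  The triangles through [v] are the edges among its
    neighbours, at most ['C(d, 2)] of them.  If [d <= t], deleting [v] leaves
    ['C(r, 2) + (t - d)] edges and the bound follows from
    ['C(t - d, 2) + 'C(d, 2) <= 'C(t, 2)].  If [d > t], it leaves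
    ['C(r.-1, 2) + s] edges with [s + d = t + r.-1], and the bound follows from
    ['C(s, 2) + 'C(d, 2) <= 'C(t, 2) + 'C(r.-1, 2)], the convexity of
    ['C(_, 2)].  This is [triangles_bound].

    Suppose equality holds.  In the first case [d] is [0] or [t] and the rest
    of the graph is again extremal; in the second case [d = r.-1] and the
    neighbours of [v] are pairwise adjacent, so that [v] and its neighbours
    form a clique on [r] vertices.  Hence an extremal graph contains a copy [B]
    of K_r ([extremal_clique]).  The bound applied after deletion of a
    non-isolated vertex outside [B] shows in the same way that this vertex has
    degree exactly [t] ([outside_degree]).  As only [t] edges are not inside
    [B], two such vertices must share all their edges, so there is one such vertex,
    or [t = 1] and there are two, joined by the only edge not inside [B]
    ([extremal_outside]).  These alternatives are the graphs of the theorem,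
    and they are told apart by connectedness.

    The value ['C(r, 3) + 'C(t, 2)] is attained by K_r with one vertex attached
    by [t] edges ([attach_complete_cliques]), so a graph with the maximum
    number of triangles satisfies the bound with equality.

    All counts are made inside a set [A] of vertices of a fixed graph, so that
    deleting a vertex is [A :\ v]. *)

Set Implicit Arguments.
Unset Strict Implicit.
Unset Printing Implicit Defensive.

(** * Counting cliques inside a set of vertices *)

Section Cliques.
Variable G : sgraph.
Implicit Types (A B K N : {set G}) (v w x y : G) (k d r t : nat).

Definition clique A : bool :=
  [forall x in A, forall y in A, (x != y) ==> adj x y].

Definition cliques k A : {set {set G}} :=
  [set K : {set G} | [&& K \subset A, #|K| == k & clique K]].

Definition neighbours A v : {set G} := [set x in A | adj v x].

Lemma cliqueP A :
  reflect {in A &, forall x y, x != y -> adj x y} (clique A).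
Proof.
apply: (iffP forall_inP) => [cA x y xA yA xy | cA x xA].
  by have /forall_inP /(_ y yA) /implyP := cA x xA; apply.
by apply/forall_inP => y yA; apply/implyP; apply: cA.
Qed.

Lemma sub_clique A B : A \subset B -> clique B -> clique A.
Proof.
move=> /subsetP AB /cliqueP cB; apply/cliqueP => x y xA yA.
by apply: cB; apply: AB.
Qed.

Lemma adj_neq x y : adj x y -> x != y.
Proof. by apply: contraTneq => ->; rewrite adj_irrefl. Qed.

Lemma cliqueU1 v K :
  K \subset [set x | adj v x] -> clique K -> clique (v |: K).
Proof.
move=> /subsetP vK /cliqueP cK; apply/cliqueP => x y.
rewrite !inE => /predU1P[-> | xK] /predU1P[-> | yK]; rewrite ?eqxx // => xy.
- by have := vK y yK; rewrite inE.
- by have := vK x xK; rewrite inE adj_sym.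
- exact: cK.
Qed.

Lemma edges_cliques : edges G = cliques 2 setT.
Proof.
apply/setP => E; rewrite inE subsetT /=; apply/imsetP/andP.
  move=> [[x y]]; rewrite inE /= => xy ->; rewrite cards2 (adj_neq xy).
  split=> //.
  apply/cliqueP => a b; rewrite !inE.
  by move=> /pred2P[-> | ->] /pred2P[-> | ->]; rewrite ?eqxx // adj_sym.
move=> [/cards2P[x [y [xy ->]]] /cliqueP cE]; exists (x, y) => //.
by rewrite inE; apply: cE; rewrite ?set21 ?set22.
Qed.

Lemma triangles_cliques : triangles G = cliques 3 setT.
Proof. by apply/setP => T; rewrite !inE subsetT. Qed.

Lemma leq_cliques k A B : A \subset B -> #|cliques k A| <= #|cliques k B|.
Proof.
move=> AB; apply/subset_leq_card/subsetP => K; rewrite !inE.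
by case/and3P=> /subset_trans/(_ AB) -> -> ->.
Qed.

Lemma card_cliques1 A : #|cliques 1 A| = #|A|.
Proof.
rewrite -[RHS]bin1 -cards_draws; apply: eq_card => K; rewrite !inE.
case: cards1P => [[x ->]|]; rewrite ?andbF // andbT andTb.
suff -> : clique [set x] by rewrite andbT.
by apply/cliqueP => a b /set1P -> /set1P ->; rewrite eqxx.
Qed.

Lemma leq_cliques_bin k A : #|cliques k A| <= 'C(#|A|, k).
Proof.
rewrite -cards_draws; apply/subset_leq_card/subsetP => K; rewrite !inE.
by case/and3P=> -> ->.
Qed.

Lemma card_cliques_clique k A : clique A -> #|cliques k A| = 'C(#|A|, k).
Proof.
move=> cA; rewrite -cards_draws; apply: eq_card => K; rewrite !inE.
by case: (boolP (K \subset A)) => //= /sub_clique ->; rewrite ?andbT.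
Qed.

Lemma clique_card_cliques2 A : #|cliques 2 A| = 'C(#|A|, 2) -> clique A.
Proof.
move=> eqC; set D := [set K : {set G} | K \subset A & #|K| == 2].
have sub : cliques 2 A \subset D.
  by apply/subsetP => K; rewrite !inE => /and3P[-> ->].
have eqD : cliques 2 A = D.
  by apply/eqP; rewrite eqEcard sub eqC cards_draws leqnn.
apply/cliqueP => x y xA yA xy.
have : [set x; y] \in cliques 2 A.
  by rewrite eqD inE subUset !sub1set xA yA cards2 xy.
rewrite inE => /and3P[_ _ /cliqueP]; apply; rewrite ?set21 ?set22 //.
Qed.

(** A clique avoids [v], or arises from a smaller clique among the neighbours
    of [v] by adding [v].  For [k = 1] this counts edges, for [k = 2]
    triangles. *)
Lemma cliques_rec k A v : v \in A ->
  #|cliques k.+1 A| = #|cliques k.+1 (A :\ v)| + #|cliques k (neighbours A v)|.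
Proof.
move=> vA; rewrite -(cardsID [set K : {set G} | v \in K]) addnC; congr (_ + _).
  apply: eq_card => K; rewrite !inE subsetD1.
  by case: (v \in K); rewrite ?andbF ?andbT.
have vN K : K \in cliques k (neighbours A v) -> v \notin K.
  rewrite inE => /and3P[/subsetP KN _ _]; apply/negP => /KN.
  by rewrite inE adj_irrefl andbF.
have inj_v : {in cliques k (neighbours A v) &, injective (fun K => v |: K)}.
  move=> K L /vN vK /vN vL eqKL.
  by rewrite -(setU1K vK) eqKL setU1K.
rewrite -(card_in_imset inj_v); apply: eq_card => K; apply/idP/imsetP.
  rewrite !inE => /andP[/and3P[KA cardK cK] vK].
  exists (K :\ v); last by rewrite setD1K.
  rewrite inE (sub_clique (subsetDl _ _) cK) andbT.
  apply/andP; split; last by move: cardK; rewrite (cardsD1 v K) vK.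
  apply/subsetP => x; rewrite !inE => /andP[xv xK].
  by rewrite (subsetP KA) //= (cliqueP _ cK) // eq_sym.
move=> [L LN ->]; have := vN L LN; move: LN; rewrite !inE eqxx /= andbT.
move=> /and3P[/subsetP LN /eqP cardL cL] vL.
rewrite cardsU1 vL cardL eqxx subUset sub1set vA /=; apply/andP; split.
  by apply/subsetP => x /LN; rewrite inE => /andP[].
by apply: cliqueU1 => //; apply/subsetP => x /LN; rewrite !inE => /andP[].
Qed.

Lemma cliques2_rec A v : v \in A ->
  #|cliques 2 A| = #|cliques 2 (A :\ v)| + #|neighbours A v|.
Proof. by move/(cliques_rec 1) ->; rewrite card_cliques1. Qed.

Lemma leq_neighboursD1 A v x :
  #|neighbours A x| <= #|neighbours (A :\ v) x| + adj x v.
Proof.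
rewrite (cardsD1 v (neighbours A x)) inE addnC leq_add //.
  apply/subset_leq_card/subsetP => y; rewrite !inE.
  by case/and3P=> -> -> ->.
by case: (v \in A).
Qed.

(** * Vertices of minimum degree *)

(** Deleting a vertex destroys at least [d] edges and lowers the other degrees
    by at most one, so the edge count is at least [d + d.-1 + ... + 1]. *)
Lemma min_degree_edges d A : A != set0 ->
  {in A, forall x, d <= #|neighbours A x|} -> 'C(d.+1, 2) <= #|cliques 2 A|.
Proof.
elim: d A => [|d IHd] A A0 degA //.
have [v vA] := set0Pn _ A0.
rewrite (cliques2_rec vA) binS bin1 leq_add ?degA //.
apply: IHd.
  have : 0 < #|neighbours A v| by apply: leq_trans (degA v vA).
  case/card_gt0P => x; rewrite inE => /andP[xA vx].
  by apply/set0Pn; exists x; rewrite !inE xA eq_sym (adj_neq vx).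
move=> x /setD1P[_ xA]; have := degA x xA.
by have := leq_neighboursD1 A v x; case: (adj x v); lia.
Qed.

Lemma bin2D a b : 'C(a + b, 2) = 'C(a, 2) + 'C(b, 2) + a * b.
Proof.
elim: a => [|a IHa]; first by rewrite add0n bin0n mul0n addn0.
by rewrite addSn !binS !bin1 IHa; lia.
Qed.

Lemma min_degree_ltn r t A v : v \in A -> t < r ->
    #|cliques 2 A| = 'C(r, 2) + t ->
    {in A, forall x, #|neighbours A v| <= #|neighbours A x|} ->
  #|neighbours A v| < r.
Proof.
move=> vA tr eA vmin; have A0 : A != set0 by apply/set0Pn; exists v.
have := min_degree_edges A0 vmin; rewrite eA; set d := #|_|.
apply: contraTltn => rd; rewrite -ltnNge.
apply: leq_trans (leq_bin2l 2 (rd : r.+1 <= d.+1)).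
by rewrite binS bin1; lia.
Qed.

Lemma exists_min_degree A : A != set0 ->
  exists2 v, v \in A & {in A, forall x, #|neighbours A v| <= #|neighbours A x|}.
Proof.
case/set0Pn => a aA.
by case: (arg_minnP (fun x => #|neighbours A x|) aA) => v vA vmin; exists v.
Qed.

(** * The maximum number of triangles *)

(** The Kruskal-Katona bound for triangles. *)
Lemma triangles_bound r t A : t < r -> #|cliques 2 A| = 'C(r, 2) + t ->
  #|cliques 3 A| <= 'C(r, 3) + 'C(t, 2).
Proof.
have [m] := ubnP #|A|; elim: m A r t => // m IHm A r t cardA tr eA.
have [A0 | A0] := eqVneq A set0.
  by apply: leq_trans (leq_cliques_bin 3 A) _; rewrite A0 cards0.
have [v vA vmin] := exists_min_degree A0.
have dr := min_degree_ltn vA tr eA vmin.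
have cardAv : #|A :\ v| < m by move: cardA; rewrite (cardsD1 v A) vA; lia.
rewrite (cliques_rec 2 vA); move: eA (leq_cliques_bin 2 (neighbours A v)) dr.
rewrite (cliques2_rec vA).
move: #|neighbours A v| #|cliques 2 (neighbours A v)| => d T eA Td dr.
have [dt | td] := leqP d t.
  have eAv : #|cliques 2 (A :\ v)| = 'C(r, 2) + (t - d) by lia.
  have := IHm _ r (t - d) cardAv ltac:(lia) eAv.
  by have := bin2D (t - d) d; rewrite subnK //; nia.
case: r tr eA dr => // q tr eA dr.
(* With [d = t + a] and [q = t + a + b], the inequality needed is
   ['C(t + b, 2) + 'C(t + a, 2) <= 'C(t, 2) + 'C(t + a + b, 2)]; the two sides
   differ by [a * b]. *)
have [a [b [dE qE]]] : exists a b, d = t + a /\ q = t + a + b.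
  by exists (d - t), (q - d); lia.
have eAv : #|cliques 2 (A :\ v)| = 'C(q, 2) + (t + b).
  by move: eA; rewrite binS bin1; lia.
have := IHm _ q (t + b) cardAv ltac:(lia) eAv.
by move: Td; rewrite (binS q) dE qE -addnA !bin2D; nia.
Qed.

(** In the induction for [triangles_bound] equality must hold at each step.
    While the degree of the deleted vertex is at most [t], the clique is found
    in what remains; otherwise the deleted vertex has degree [r.-1] and spans
    the clique with its neighbours.  For [r = 1] the claim fails on the empty
    set. *)
Lemma extremal_clique r t A : 1 < r -> t < r ->
    #|cliques 2 A| = 'C(r, 2) + t -> #|cliques 3 A| = 'C(r, 3) + 'C(t, 2) ->
  exists B, [/\ B \subset A, clique B & #|B| = r].
Proof.
have [m] := ubnP #|A|; elim: m A t => // m IHm A t cardA r1 tr eA tA.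
have A0 : A != set0.
  apply: contra_eq_neq eA => /= ->; rewrite ltn_eqF //.
  apply: leq_ltn_trans (leq_cliques_bin 2 set0) _; rewrite cards0 /=.
  by rewrite addn_gt0 bin_gt0 r1.
have [v vA vmin] := exists_min_degree A0.
have dr := min_degree_ltn vA tr eA vmin.
have cardAv : #|A :\ v| < m by move: cardA; rewrite (cardsD1 v A) vA; lia.
have Td := leq_cliques_bin 2 (neighbours A v).
rewrite (cliques2_rec vA) in eA; rewrite (cliques_rec 2 vA) in tA.
have [dt | td] := leqP #|neighbours A v| t.
  have eAv : #|cliques 2 (A :\ v)| = 'C(r, 2) + (t - #|neighbours A v|) by lia.
  have tAv := triangles_bound (leq_ltn_trans (leq_subr _ _) tr) eAv.
  have := bin2D (t - #|neighbours A v|) #|neighbours A v|.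
  rewrite subnK // => binE.
  have tdr := leq_ltn_trans (leq_subr #|neighbours A v| t) tr.
  have [|B [BA cB rB]] := IHm _ _ cardAv r1 tdr eAv.
    by nia.
  by exists B; split=> //; apply: subset_trans BA (subsetDl _ _).
case: r {IHm} r1 tr eA tA dr => // q r1 tr eA tA dr.
have [a [b [dE qE]]] : exists a b, #|neighbours A v| = t + a /\ q = t + a + b.
  by exists (#|neighbours A v| - t), (q - #|neighbours A v|); lia.
have eAv : #|cliques 2 (A :\ v)| = 'C(q, 2) + (t + b).
  by move: eA; rewrite binS bin1; lia.
have tbq : t + b < q by lia.
have tAv := triangles_bound tbq eAv.
(* Here [a > 0], and the bound falls short of equality by at least [a * b]. *)
have [b0 T_eq] :
    b = 0 /\ #|cliques 2 (neighbours A v)| = 'C(#|neighbours A v|, 2).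
  move: tA Td tAv; rewrite (binS q) dE qE -[t + a + b]addnA !bin2D.
  by move=> tA Td tAv; have [b0 | b0] := posnP b; [subst b; lia | nia].
exists (v |: neighbours A v); split.
- by rewrite subUset sub1set vA; apply/subsetP => z; rewrite inE => /andP[].
- apply: cliqueU1 (clique_card_cliques2 T_eq).
  by apply/subsetP => z; rewrite !inE => /andP[].
- by rewrite cardsU1 inE adj_irrefl andbF /= dE qE b0 addn0.
Qed.

(** * Vertices outside the clique *)

Lemma outside_degree_leq t B w : clique B -> w \notin B ->
    #|cliques 2 [set: G]| = 'C(#|B|, 2) + t ->
  #|neighbours setT w| <= t.
Proof.
move=> cB wB eG; have BT : B \subset [set: G] :\ w by rewrite subsetD1 subsetT.
have := leq_cliques 2 BT; rewrite card_cliques_clique //.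
by move: eG; rewrite (cliques2_rec (in_setT w)); lia.
Qed.

(** Deleting [w], of degree [d], leaves ['C(#|B|, 2) + (t - d)] edges, so
    [triangles_bound] and equality give
    ['C(t, 2) <= 'C(t - d, 2) + 'C(d, 2)], that is, [(t - d) * d = 0]. *)
Lemma outside_degree t B w : clique B -> w \notin B -> t < #|B| ->
    #|cliques 2 [set: G]| = 'C(#|B|, 2) + t ->
    #|cliques 3 [set: G]| = 'C(#|B|, 3) + 'C(t, 2) ->
    0 < #|neighbours setT w| ->
  #|neighbours setT w| = t.
Proof.
move=> cB wB tr eG tG d0; have dt := outside_degree_leq cB wB eG.
have := leq_cliques_bin 2 (neighbours setT w).
move: eG tG; rewrite (cliques2_rec (in_setT w)) (cliques_rec 2 (in_setT w)).
move: #|neighbours setT w| #|cliques 2 (neighbours setT w)| d0 dt.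
move=> d T d0 dt eG tG Td.
have eGw : #|cliques 2 ([set: G] :\ w)| = 'C(#|B|, 2) + (t - d) by lia.
have := triangles_bound (leq_ltn_trans (leq_subr d t) tr) eGw.
by have := bin2D (t - d) d; rewrite subnK //; nia.
Qed.

(** Only [t] edges are not inside [B], and [w] is on all of them; those of [w']
    are among them, and at most one edge can contain both vertices. *)
Lemma two_outside t B w w' : clique B -> w \notin B -> w' \notin B -> w != w' ->
    #|cliques 2 [set: G]| = 'C(#|B|, 2) + t ->
    #|neighbours setT w| = t -> #|neighbours setT w'| = t ->
  t <= adj w' w.
Proof.
move=> cB wB w'B ww' eG dw dw'.
have BT : B \subset [set: G] :\ w :\ w' by rewrite !subsetD1 subsetT wB.
have := leq_cliques 2 BT; rewrite card_cliques_clique // => eB.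
have w'T : w' \in [set: G] :\ w by rewrite !inE eq_sym ww'.
have := leq_neighboursD1 setT w w'; rewrite dw'.
by move: eG; rewrite (cliques2_rec (in_setT w)) (cliques2_rec w'T) dw; lia.
Qed.

Lemma adj_degree1 w w' x :
  #|neighbours setT w| = 1 -> adj w w' -> adj w x = (x == w').
Proof.
move=> /eqP/cards1P[u Nu] ww'.
have Nw y : adj w y = (y == u) by rewrite -in_set1 -Nu !inE.
by move: ww'; rewrite !Nw => /eqP ->.
Qed.

Lemma extremal_outside t B : clique B -> 0 < t < #|B| -> no_isolated G ->
    #|cliques 2 [set: G]| = 'C(#|B|, 2) + t ->
    #|cliques 3 [set: G]| = 'C(#|B|, 3) + 'C(t, 2) ->
  exists2 w, #|neighbours setT w| = t &
    ~: B = [set w] \/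
    exists w', [/\ t = 1, w != w', adj w w', #|neighbours setT w'| = 1
                 & ~: B = [set w; w']].
Proof.
move=> cB /andP[t0 tr] isoG eG tG.
have deg w : w \notin B -> #|neighbours setT w| = t.
  move=> wB; apply: outside_degree eG tG _ => //.
  by have [y wy] := isoG w; apply/card_gt0P; exists y; rewrite !inE.
have [w wB] : exists w, w \in ~: B.
  apply/set0Pn; apply: contraTneq t0 => /(congr1 (fun A => ~: A)).
  rewrite setCK setC0 => BT; move: eG.
  by rewrite -BT card_cliques_clique //; lia.
rewrite inE in wB; exists w; first exact: deg.
have [/eqP sub | ] := boolP (~: B :\ w == set0).
  left; apply/setP => x; have := in_set0 x; rewrite -sub !inE.
  by case: eqVneq => [-> _ | _ /= ->].
case/set0Pn => w'; rewrite !inE => /andP[w'w w'B]; right; exists w'.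
have ww' : w != w' by rewrite eq_sym.
have := two_outside cB w'B wB w'w eG (deg _ w'B) (deg _ wB).
case: (boolP (adj w w')) => [aww' t1 | _]; last by lia.
have {}t1 : t = 1 by lia.
have dw' : #|neighbours setT w'| = 1 by rewrite deg.
split=> //; apply/setP => x; rewrite !inE.
apply/idP/pred2P => [xB | [->|->] //].
have [-> | xw] := eqVneq x w; first by left.
have [-> | xw'] := eqVneq x w'; first by right.
have := two_outside cB xB w'B xw' eG (deg _ xB) (deg _ w'B).
by rewrite t1 (adj_degree1 _ dw' (_ : adj w' w)) ?(negPf xw) // adj_sym.
Qed.

(** * Connectedness of the two extremal configurations *)

Lemma connected_outside1 B w : clique B -> ~: B = [set w] ->
  0 < #|neighbours setT w| -> connected_graph G.
Proof.
move=> cB outB /card_gt0P[u]; rewrite !inE /= => wu.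
have inB x : (x \in B) = (x != w) by rewrite -in_set1 -outB inE negbK.
suff to_u x : connect (@adj G) x u.
  move=> x y.
  by rewrite (connect_trans (to_u x)) // (sym_connect_sym (@adj_sym G)).
have [-> | xw] := eqVneq x w; first exact: connect1.
have [-> | xu] := eqVneq x u; first exact: connect0.
by apply/connect1/(cliqueP _ cB); rewrite ?inB // eq_sym (adj_neq wu).
Qed.

Lemma disconnected_outside2 B w w' : B != set0 -> ~: B = [set w; w'] ->
    adj w w' -> #|neighbours setT w| = 1 -> #|neighbours setT w'| = 1 ->
  ~ connected_graph G.
Proof.
move=> /set0Pn[b bB] outB ww' dw dw' /(_ w b).
have w'w : adj w' w by rewrite adj_sym.
have clB : closed (@adj G) (~: B).
  apply: (intro_closed (sym_connect_sym (@adj_sym G))) => x y xy.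
  rewrite outB !inE => /pred2P[] xE; move: xy.
    by rewrite xE (adj_degree1 _ dw ww') => ->; rewrite orbT.
  by rewrite xE (adj_degree1 _ dw' w'w) => ->.
move/(closed_connect clB); rewrite !inE bB.
by rewrite -[w \in B]negbK -in_setC outB set21.
Qed.

End Cliques.

(** * Identifying the extremal graphs *)

(** The isomorphisms are easier to give from the standard graph, whose vertices
    are built from ordinals, by enumerating the clique. *)
Lemma isomorphic_from_inj (G H : sgraph) (h : H -> G) :
  injective h -> #|G| <= #|H| -> {mono h : x y / adj x y} -> isomorphic G H.
Proof.
move=> inj_h leGH mono_h; have [f hf fh] := inj_card_bij inj_h leGH.
exists f; first by exists h.
by move=> x y; rewrite -mono_h !fh.
Qed.

Lemma clique_adj (G : sgraph) (B : {set G}) : clique B ->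
  {in B &, forall x y, adj x y = (x != y)}.
Proof.
move=> cB x y xB yB; apply/idP/idP; first exact: adj_neq.
exact: (cliqueP _ cB).
Qed.

Lemma isomorphic_complete (G : sgraph) :
  clique [set: G] -> isomorphic G (complete #|[set: G]|).
Proof.
move=> cG.
pose h (i : complete #|[set: G]|) : G := enum_val (i : 'I_#|[set: G]|).
apply: (@isomorphic_from_inj _ _ h); first exact: enum_val_inj.
  by rewrite card_ord cardsT.
by move=> i j; rewrite (clique_adj cG) ?inE // (inj_eq enum_val_inj).
Qed.

Lemma isomorphic_attach (G : sgraph) (B : {set G}) (w : G) :
    clique B -> ~: B = [set w] ->
  exists2 S : {set complete #|B|}, #|S| = #|neighbours setT w| &
    isomorphic G (attach_vertex S).
Proof.
move=> cB outB.
have inB x : (x \in B) = (x != w) by rewrite -in_set1 -outB inE negbK.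
pose g (i : complete #|B|) : G := enum_val (i : 'I_#|B|).
have gB i : g i \in B by apply: enum_valP.
have g_inj : injective g by apply: enum_val_inj.
exists [set i | adj w (g i)].
  rewrite -(card_imset _ g_inj); apply: eq_card => x; apply/imsetP/idP.
    by move=> [i]; rewrite !inE => wi ->.
  rewrite !inE /= => wx; have xB : x \in B by rewrite inB eq_sym adj_neq.
  by exists (enum_rank_in xB x); rewrite ?inE /g enum_rankK_in.
pose h (u : option (complete #|B|)) : G := if u is Some i then g i else w.
apply: (@isomorphic_from_inj _ (attach_vertex _) h).
- move=> [i|] [j|] //=; first by move/g_inj ->.
    by move=> gw; have := gB i; rewrite inB gw eqxx.
  by move=> gw; have := gB j; rewrite inB -gw eqxx.
- by rewrite card_option card_ord -(cardsC B) outB cards1 addn1.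
- move=> [i|] [j|] /=; rewrite ?inE ?adj_irrefl //.
    by rewrite (clique_adj cB) // (inj_eq g_inj).
  by rewrite adj_sym.
Qed.

Lemma isomorphic_union (G : sgraph) (B : {set G}) (w w' : G) :
    clique B -> ~: B = [set w; w'] -> adj w w' ->
    #|neighbours setT w| = 1 -> #|neighbours setT w'| = 1 ->
  isomorphic G (disjoint_union (complete 2) (complete #|B|)).
Proof.
move=> cB outB ww' dw dw'; have w'w : adj w' w by rewrite adj_sym.
have adjw x := adj_degree1 x dw ww'; have adjw' x := adj_degree1 x dw' w'w.
have wC x : x \in B -> (x == w = false) * (x == w' = false).
  rewrite -[_ \in _]negbK -in_setC outB !inE.
  by case/norP=> /negPf-> /negPf->.
pose g (i : complete #|B|) : G := enum_val (i : 'I_#|B|).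
have gB i : g i \in B by apply: enum_valP.
have g_inj : injective g by apply: enum_val_inj.
pose e (i : complete 2) : G := if i == ord0 :> 'I_2 then w else w'.
pose h (u : complete 2 + complete #|B|) : G :=
  match u with inl i => e i | inr i => g i end.
have e_adj i j : adj (e i) (e j) = (i != j).
  rewrite /e; case: i j => [[|[|//]] p] [[|[|//]] q];
  by rewrite -!val_eqE /= ?adj_irrefl ?ww' ?w'w.
have eg_adj i j : adj (e i) (g j) = false.
  by rewrite /e; case: ifP; rewrite ?adjw ?adjw' (wC _ (gB j)).
have h_adj : {mono h : x y / @adj (disjoint_union _ _) x y >-> adj x y}.
  move=> [i|i] [j|j] /=; rewrite ?e_adj ?eg_adj //.
    by rewrite adj_sym eg_adj.
  by rewrite (clique_adj cB) // (inj_eq g_inj).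
apply: (@isomorphic_from_inj _ (disjoint_union _ _) h) => //.
  move=> [i|i] [j|j] //= E.
  - congr inl; apply/eqP; apply: contraFT (adj_irrefl (e i)) => ij.
    by rewrite {2}E e_adj.
  - have := gB j; rewrite -E => /wC.
    by rewrite /e; case: ifP; rewrite eqxx => _ [].
  - have := gB i; rewrite E => /wC.
    by rewrite /e; case: ifP; rewrite eqxx => _ [].
  - by rewrite (g_inj _ _ E).
rewrite card_sum !card_ord -(cardsC B) outB addnC cards2.
by case: (_ != _).
Qed.

(** * The comparison graph and the theorem *)

Lemma attach_complete_cliques r (S : {set complete r}) k :
  #|cliques k.+1 [set: attach_vertex S]| = 'C(r, k.+1) + 'C(#|S|, k).
Proof.
have Some_inj : injective (@Some (complete r) : _ -> attach_vertex S).
  by move=> x y [].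
have clique_Some (A : {set complete r}) :
    clique ((Some : _ -> attach_vertex S) @: A).
  apply/cliqueP => _ _ /imsetP[x xA ->] /imsetP[y yA ->].
  by rewrite (inj_eq Some_inj).
rewrite (cliques_rec k (in_setT (None : attach_vertex S))).
have -> : [set: attach_vertex S] :\ None =
    (Some : _ -> attach_vertex S) @: setT.
  apply/setP => -[x|]; rewrite !inE /=; apply/esym.
    by apply/imsetP; exists x.
  by apply/negP => /imsetP[].
have -> : neighbours [set: attach_vertex S] None =
    (Some : _ -> attach_vertex S) @: S.
  apply/setP => -[x|]; rewrite !inE /=; apply/esym.
    by rewrite (mem_imset _ _ Some_inj).
  by apply/negP => /imsetP[].
by rewrite !card_cliques_clique // !card_imset // cardsT card_ord.
Qed.

Theorem theorem2p7 (n r t : nat) (G : sgraph)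
    (n_gt0 : 0 < n) (r_gt0 : 0 < r)
    (n_bounds : 'C(r, 2) <= n < 'C(r.+1, 2))
    (t_def : t = n - 'C(r, 2))
    (G_no_isolated : no_isolated G)
    (G_edges : #|edges G| = n)
    (G_max : forall H : sgraph, #|edges H| = n ->
               #|triangles H| <= #|triangles G|) :
  [/\ t = 0 -> isomorphic G (complete r),
      t = 1 -> connected_graph G ->
        exists u : complete r, isomorphic G (attach_vertex [set u]),
      t = 1 -> ~ connected_graph G ->
        isomorphic G (disjoint_union (complete 2) (complete r)) &
      t <> 0 /\ t <> 1 ->
        exists2 S : {set complete r}, #|S| = t &
          isomorphic G (attach_vertex S)].
Proof.
have [tr nE] : t < r /\ n = 'C(r, 2) + t.
  by move: n_bounds; rewrite binS bin1; lia.
have r1 : 1 < r.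
  by rewrite ltnNge; apply: contraL n_gt0 => r1; rewrite nE bin_small //; lia.
have eG : #|cliques 2 [set: G]| = 'C(r, 2) + t.
  by rewrite -edges_cliques G_edges.
have tG : #|cliques 3 [set: G]| = 'C(r, 3) + 'C(t, 2).
  apply/eqP; rewrite eqn_leq (triangles_bound tr eG) /=.
  have [S St] : exists S : {set complete r}, #|S| = t.
    exists [set widen_ord (ltnW tr) i | i : 'I_t].
    rewrite card_imset; first by rewrite card_ord.
    by move=> i j /(congr1 val) /= /val_inj.
  rewrite -St -attach_complete_cliques -!triangles_cliques; apply: G_max.
  by rewrite edges_cliques attach_complete_cliques bin1 St nE.
have [B [_ cB rB]] := extremal_clique r1 tr eG tG.
case: r / rB r1 tr eG tG {n_bounds t_def r_gt0 nE} => r1 tr eG tG.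
(* For [t = 0] a vertex outside [B] has degree [0], which is excluded. *)
have [t0 | t_gt0] := posnP t.
  split; [move=> _ | by rewrite t0 | by rewrite t0 | by case].
  suff BT : B = [set: G] by move: cB; rewrite BT; apply: isomorphic_complete.
  apply/eqP; rewrite -subTset; apply/subsetP => w _; apply: contraT => wB.
  have [u wu] := G_no_isolated w; have := outside_degree_leq cB wB eG.
  by rewrite t0 leqn0 cards_eq0 => /eqP/setP/(_ u); rewrite !inE wu.
have t0r : 0 < t < #|B| by rewrite t_gt0.
have [w dw [outB | [w' [t1 ww' aww' dw' outB]]]] :=
    extremal_outside cB t0r G_no_isolated eG tG.
  have conG : connected_graph G.
    by apply: connected_outside1 cB outB _; rewrite dw.
  have [S St isoG] := isomorphic_attach cB outB; rewrite dw in St.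
  split=> [t0 | t1 _ | _ /(_ conG) // | _]; last by exists S.
    by rewrite t0 in t_gt0.
  by move: St isoG; rewrite t1 => /eqP/cards1P[u ->]; exists u.
rewrite t1 in dw; have B0 : B != set0 by rewrite -card_gt0 ltnW.
split=> [| _ conG | _ _ | [_ /(_ t1)//]]; first by rewrite t1.
  by have := disconnected_outside2 B0 outB aww' dw dw' conG.
exact: isomorphic_union outB aww' dw dw'.
Qed.
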